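(* The presheaf monad $\mathbb{P}=(P,m,y)$ on $V\text{-}\mathbf{Cat}$ satisfies fully BC*; that is, the functor $P$ and the natural transformations $m$ and $y$ all satisfy BC*.
   Context: $V$ is a commutative unital quantale: a complete lattice with a commutative, associative tensor $\otimes$, with unit $k\neq\bot$, preserving arbitrary joins in each variable; $\hom(u,-)$ is right adjoint to $u\otimes-$. A $V$-category $(X,a)$ is a set $X$ with $a:X\times X\to V$ (also written $X(x,x')=a(x,x')$) such that $k\le a(x,x)$ and $a(x,x')\otimes a(x',x'')\le a(x,x'')$; a $V$-functor $f:(X,a)\to(Y,b)$ is a map with $a(x,x')\le b(f(x),f(x'))$. A $V$-distributor $\varphi$ from $(X,a)$ to $(Y,b)$ is a map $\varphi:X\times Y\to V$ with $\varphi\cdot a\le\varphi$ and $b\cdot\varphi\le\varphi$, where composition is $(s\cdot r)(x,z)=\bigvee_y r(x,y)\otimes s(y,z)$ and order is pointwise. A $V$-functor $f:X\to Y$ induces distributors $f_*$ from $X$ to $Y$, $f_*(x,y)=Y(f(x),y)$, and $f^*$ from $Y$ to $X$, $f^*(y,x)=Y(y,f(x))$. $E=(\{*\},k)$ is the one-point $V$-category; a point $x\in X$ is identified with the $V$-functor $E\to X$ with value $x$, so $x^*$ is the distributor $X(-,x)$ from $X$ to $E$. Presheaf monad $\mathbb{P}=(P,m,y)$: $PX$ is the set of distributors from $X$ to $E$ with $PX(\varphi,\psi)=\bigwedge_{x\in X}\hom(\varphi(x),\psi(x))$ (writing $\varphi(x)=\varphi(x,* )$); $Pf(\varphi)=\varphi\cdot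 f^*$; $y_X(x)=x^*$; $m_X:PPX\to PX$, $m_X(\Gamma)=\Gamma\cdot(y_X)_*$ (the right adjoint of $Py_X$). A commutative square of $V$-functors $h\cdot l=f\cdot g$, with $l:W\to Z$ (top), $g:W\to X$ (left), $h:Z\to Y$ (right), $f:X\to Y$ (bottom), is a BC*-square if $h^*\cdot f_*=l_*\cdot g^*$ (equivalently $h^*\cdot f_*\le l_*\cdot g^*$). A functor $T:V\text{-}\mathbf{Cat}\to V\text{-}\mathbf{Cat}$ satisfies BC* if it preserves BC*-squares. A natural transformation $\alpha:T\to T'$ satisfies BC* if, for every $V$-functor $f:X\to Y$, the naturality square with top $\alpha_X$, left $Tf$, right $T'f$, bottom $\alpha_Y$ is a BC*-square. *)

(* Defs.v *)
From HB Require Import structures.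
From mathcomp Require Import all_boot all_order.
From mathcomp Require Import boolp classical_sets.

Set Implicit Arguments.
Unset Strict Implicit.
Unset Printing Implicit Defensive.

Import Order.TTheory.

Local Open Scope classical_set_scope.
Local Open Scope order_scope.

Reserved Notation "u ⊗ v" (at level 40, left associativity).

(* A complete lattice is a partial order with least upper bounds of arbitrary
   subsets.  As the tensor is commutative, its preservation of joins is only
   required in the second variable; see [tens_supl] for the first one. *)
HB.mixin Record isQuantale (d : Order.disp_t) V of Order.POrder d V := {
  qsup : set V -> V;
  tens : V -> V -> V;
  qunit : V;
  qsup_isLub : forall A : set V, isLub A (qsup A);
  tensA : associative tens;
  tensC : commutative tens;
  tens1q : left_id qunit tens;
  tens_supr : forall (u : V) (A : set V),
    tens u (qsup A) = qsup [set tens u v | v in A];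
  qunit_neq_bot : qunit <> qsup set0
}.

#[short(type="quantaleType")]
HB.structure Definition Quantale (d : Order.disp_t) :=
  { V of Order.POrder d V & isQuantale d V }.

Notation "u ⊗ v" := (tens u v) : order_scope.

Section QuantaleTheory.
Context {d : Order.disp_t} {V : quantaleType d}.
Implicit Types (u v w : V) (A : set V).

Definition qinf A : V := qsup (lbound A).

Definition qhom u v : V := qsup [set w | u ⊗ w <= v].

Definition bigjoin (I : Type) (F : I -> V) : V := qsup (range F).
Definition bigmeet (I : Type) (F : I -> V) : V := qinf (range F).

Lemma qsup_ub A v : A v -> v <= qsup A.
Proof. by case: (qsup_isLub A) => ub _; apply: ub. Qed.

Lemma qsup_le A v : (forall w, A w -> w <= v) -> qsup A <= v.
Proof. by case: (qsup_isLub A) => _ le_ub; apply: le_ub. Qed.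

Lemma tens_supl A u : qsup A ⊗ u = qsup [set v ⊗ u | v in A].
Proof.
rewrite tensC tens_supr; congr qsup.
by apply/seteqP; split=> w [v Av <-]; exists v; rewrite // tensC.
Qed.

Lemma tensq1 : right_id qunit (@tens d V).
Proof. by move=> u; rewrite tensC tens1q. Qed.

Lemma le_bigjoin (I : Type) (F : I -> V) (i : I) : F i <= bigjoin F.
Proof. by apply: qsup_ub; exists i. Qed.

Lemma bigjoin_le (I : Type) (F : I -> V) v :
  (forall i, F i <= v) -> bigjoin F <= v.
Proof. by move=> Fv; apply: qsup_le => _ [i _ <-]. Qed.

Lemma bigmeet_le (I : Type) (F : I -> V) (i : I) : bigmeet F <= F i.
Proof. by apply: qsup_le => w; apply; exists i. Qed.

Lemma le_bigmeet (I : Type) (F : I -> V) v :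
  (forall i, v <= F i) -> v <= bigmeet F.
Proof. by move=> vF; apply: qsup_ub => _ [i _ <-]. Qed.

Lemma tens_bigjoinr u (I : Type) (F : I -> V) :
  u ⊗ bigjoin F = bigjoin (fun i => u ⊗ F i).
Proof. by rewrite /bigjoin tens_supr image_comp. Qed.

Lemma tens_bigjoinl (I : Type) (F : I -> V) u :
  bigjoin F ⊗ u = bigjoin (fun i => F i ⊗ u).
Proof. by rewrite /bigjoin tens_supl image_comp. Qed.

Lemma tens_ler u v w : v <= w -> u ⊗ v <= u ⊗ w.
Proof.
move=> vw; have <- : qsup [set x | x = v \/ x = w] = w.
  apply/le_anti/andP; split; first by apply: qsup_le => x [] ->.
  by apply: qsup_ub; right.
by rewrite tens_supr; apply: qsup_ub; exists v => //; left.
Qed.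

Lemma tens_le u u' v v' : u <= u' -> v <= v' -> u ⊗ v <= u' ⊗ v'.
Proof.
move=> uu' vv'; apply: (le_trans (tens_ler u vv')).
by rewrite tensC [u' ⊗ _]tensC; apply: tens_ler.
Qed.

Lemma qhom_adj u v w : (u ⊗ w <= v) = (w <= qhom u v).
Proof.
apply/idP/idP => [uwv|wuv]; first exact: qsup_ub.
apply: (le_trans (tens_ler u wuv)); rewrite /qhom tens_supr.
by apply: qsup_le => _ [x ux <-].
Qed.

End QuantaleTheory.

Section VCategories.
Context {d : Order.disp_t} (V : quantaleType d).

Record vcat := VCat {
  vobj :> Type;
  vhom : vobj -> vobj -> V;
  vhom_refl : forall x, qunit <= vhom x x;
  vhom_trans : forall x y z, vhom x y ⊗ vhom y z <= vhom x z
}.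

Record vfunctor (X Y : vcat) := VFunctor {
  vfun :> X -> Y;
  vfunP : forall x x', vhom x x' <= vhom (vfun x) (vfun x')
}.

Definition vrel (X Y : Type) := X -> Y -> V.

Definition rle X Y (r s : vrel X Y) : Prop := forall x y, r x y <= s x y.

(* Diagrammatic order: [rcomp r s] is the composite written s . r. *)
Definition rcomp X Y Z (r : vrel X Y) (s : vrel Y Z) : vrel X Z :=
  fun x z => bigjoin (fun y => r x y ⊗ s y z).

Record distributor (X Y : vcat) := Distributor {
  dist :> X -> Y -> V;
  dist_left : rle (rcomp (@vhom X) dist) dist;
  dist_right : rle (rcomp dist (@vhom Y)) dist
}.

End VCategories.

Arguments vhom {d V v}.

Section VCategoryTheory.
Context {d : Order.disp_t} {V : quantaleType d}.
Implicit Types X Y Z W : vcat V.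

Lemma vfunctor_ext X Y (f g : vfunctor X Y) : f =1 g -> f = g.
Proof.
case: f g => [f fP] [g gP] /= /funext fg; subst g.
by congr VFunctor; apply: Prop_irrelevance.
Qed.

Lemma distributor_ext X Y (r s : distributor X Y) :
  (forall x y, r x y = s x y) -> r = s.
Proof.
case: r s => [r rl rr] [s sl sr] /= rs.
have {}rs : r = s by apply/funext => x; apply/funext => y.
by subst s; congr Distributor; apply: Prop_irrelevance.
Qed.

Lemma dist_hom_left X Y (r : distributor X Y) x x' y :
  vhom x x' ⊗ r x' y <= r x y.
Proof.
exact: le_trans (le_bigjoin (fun z => vhom x z ⊗ r z y) x') (dist_left r x y).
Qed.

Lemma dist_hom_right X Y (r : distributor X Y) x y y' :
  r x y ⊗ vhom y y' <= r x y'.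
Proof.
exact: le_trans (le_bigjoin (fun z => r x z ⊗ vhom z y') y) (dist_right r x y').
Qed.

Definition vid X : vfunctor X X :=
  @VFunctor d V X X (fun x => x) (fun x x' => lexx (vhom x x')).

Lemma vcomp_subproof X Y Z (g : vfunctor Y Z) (f : vfunctor X Y) x x' :
  vhom x x' <= vhom (g (f x)) (g (f x')).
Proof. exact: le_trans (vfunP f x x') (vfunP g _ _). Qed.

Definition vcomp X Y Z (g : vfunctor Y Z) (f : vfunctor X Y) : vfunctor X Z :=
  VFunctor (vcomp_subproof g f).

(* Applicative order: [dcomp s r] is s . r. *)
Section DistributorComposition.
Variables (X Y Z : vcat V) (s : distributor Y Z) (r : distributor X Y).

Lemma dcomp_left : rle (rcomp vhom (rcomp r s)) (rcomp r s).
Proof.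
move=> x z; apply: bigjoin_le => x'; rewrite tens_bigjoinr.
apply: bigjoin_le => y; rewrite tensA.
apply: le_trans (le_bigjoin (fun y => r x y ⊗ s y z) y).
by apply: tens_le => //; apply: dist_hom_left.
Qed.

Lemma dcomp_right : rle (rcomp (rcomp r s) vhom) (rcomp r s).
Proof.
move=> x z; apply: bigjoin_le => z'; rewrite tens_bigjoinl.
apply: bigjoin_le => y; rewrite -tensA.
apply: le_trans (le_bigjoin (fun y => r x y ⊗ s y z) y).
by apply: tens_le => //; apply: dist_hom_right.
Qed.

Definition dcomp : distributor X Z := Distributor dcomp_left dcomp_right.

End DistributorComposition.

Section InducedDistributors.
Variables (X Y : vcat V) (f : vfunctor X Y).

Lemma lower_star_left :
  rle (rcomp vhom (fun x y => vhom (f x) y)) (fun x y => vhom (f x) y).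
Proof.
move=> x y; apply: bigjoin_le => x'.
exact: le_trans (tens_le (vfunP f x x') (lexx _)) (vhom_trans _ _ _).
Qed.

Lemma lower_star_right :
  rle (rcomp (fun x y => vhom (f x) y) vhom) (fun x y => vhom (f x) y).
Proof. by move=> x y; apply: bigjoin_le => y'; apply: vhom_trans. Qed.

Definition lower_star : distributor X Y :=
  Distributor lower_star_left lower_star_right.

Lemma upper_star_left :
  rle (rcomp vhom (fun y x => vhom y (f x))) (fun y x => vhom y (f x)).
Proof. by move=> y x; apply: bigjoin_le => y'; apply: vhom_trans. Qed.

Lemma upper_star_right :
  rle (rcomp (fun y x => vhom y (f x)) vhom) (fun y x => vhom y (f x)).
Proof.
move=> y x; apply: bigjoin_le => x'.
exact: le_trans (tens_le (lexx _) (vfunP f x' x)) (vhom_trans _ _ _).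
Qed.

Definition upper_star : distributor Y X :=
  Distributor upper_star_left upper_star_right.

End InducedDistributors.

Lemma vone_trans (x y z : unit) : (qunit : V) ⊗ qunit <= qunit.
Proof. by rewrite tens1q. Qed.

Definition vone : vcat V :=
  @VCat d V unit (fun _ _ => qunit) (fun _ => lexx _) vone_trans.

Lemma vpoint_subproof X (x : X) (e e' : vone) : vhom e e' <= vhom x x.
Proof. exact: vhom_refl. Qed.

Definition vpoint X (x : X) : vfunctor vone X :=
  @VFunctor d V vone X (fun _ => x) (vpoint_subproof x).

(* The square    l
              W ---> Z
            g |      | h
              v      v
              X ---> Y
                 f          *)
Definition BCstar_square W X Y Z (l : vfunctor W Z) (g : vfunctor W X)
    (h : vfunctor Z Y) (f : vfunctor X Y) : Prop :=
  vcomp h l = vcomp f g /\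
  dcomp (upper_star h) (lower_star f) = dcomp (lower_star l) (upper_star g).

End VCategoryTheory.

Arguments vone {d} V.

Section Monads.
Context {d : Order.disp_t} (V : quantaleType d).

Record endofunctor := Endofunctor {
  fobj :> vcat V -> vcat V;
  fmap : forall X Y, vfunctor X Y -> vfunctor (fobj X) (fobj Y);
  fmap_id : forall X, fmap (vid X) = vid (fobj X);
  fmap_comp : forall X Y Z (g : vfunctor Y Z) (f : vfunctor X Y),
    fmap (vcomp g f) = vcomp (fmap g) (fmap f)
}.

Record nattrans (T T' : endofunctor) := NatTrans {
  ncomp :> forall X, vfunctor (T X) (T' X);
  naturality : forall X Y (f : vfunctor X Y),
    vcomp (fmap T' f) (ncomp X) = vcomp (ncomp Y) (fmap T f)
}.

Definition id_endofunctor : endofunctor :=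
  @Endofunctor (fun X => X) (fun _ _ f => f) (fun _ => erefl)
    (fun _ _ _ _ _ => erefl).

Lemma comp_fmap_id (S T : endofunctor) X :
  fmap S (fmap T (vid X)) = vid (S (T X)).
Proof. by rewrite !fmap_id. Qed.

Lemma comp_fmap_comp (S T : endofunctor) X Y Z (g : vfunctor Y Z)
    (f : vfunctor X Y) :
  fmap S (fmap T (vcomp g f)) =
  vcomp (fmap S (fmap T g)) (fmap S (fmap T f)).
Proof. by rewrite !fmap_comp. Qed.

Definition comp_endofunctor (S T : endofunctor) : endofunctor :=
  @Endofunctor (fun X => S (T X)) (fun _ _ f => fmap S (fmap T f))
    (comp_fmap_id S T) (@comp_fmap_comp S T).

Record monad := Monad {
  mfun :> endofunctor;
  mmul : nattrans (comp_endofunctor mfun mfun) mfun;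
  munit : nattrans id_endofunctor mfun;
  mmul_assoc : forall X,
    vcomp (mmul X) (fmap mfun (mmul X)) = vcomp (mmul X) (mmul (mfun X));
  mmul_unitl : forall X, vcomp (mmul X) (munit (mfun X)) = vid (mfun X);
  mmul_unitr : forall X, vcomp (mmul X) (fmap mfun (munit X)) = vid (mfun X)
}.

Definition functor_BCstar (T : endofunctor) : Prop :=
  forall W X Y Z (l : vfunctor W Z) (g : vfunctor W X) (h : vfunctor Z Y)
    (f : vfunctor X Y),
    BCstar_square l g h f ->
    BCstar_square (fmap T l) (fmap T g) (fmap T h) (fmap T f).

Definition nattrans_BCstar (T T' : endofunctor) (alpha : nattrans T T') : Prop :=
  forall X Y (f : vfunctor X Y),
    BCstar_square (alpha X) (fmap T f) (fmap T' f) (alpha Y).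

Definition fully_BCstar (M : monad) : Prop :=
  [/\ functor_BCstar M, nattrans_BCstar (mmul M) & nattrans_BCstar (munit M)].

End Monads.

Section PresheafMonad.
Context {d : Order.disp_t} (V : quantaleType d).
Implicit Types X Y Z : vcat V.

Definition psh_hom X (phi psi : distributor X (vone V)) : V :=
  bigmeet (fun x : X => qhom (phi x tt) (psi x tt)).

Lemma psh_hom_refl X (phi : distributor X (vone V)) : qunit <= psh_hom phi phi.
Proof. by apply: le_bigmeet => x; rewrite -qhom_adj tensq1. Qed.

Lemma psh_homP X (phi psi : distributor X (vone V)) x :
  phi x tt ⊗ psh_hom phi psi <= psi x tt.
Proof. by rewrite qhom_adj; apply: (bigmeet_le _ x). Qed.

Lemma psh_hom_trans X (phi psi chi : distributor X (vone V)) :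
  psh_hom phi psi ⊗ psh_hom psi chi <= psh_hom phi chi.
Proof.
apply: le_bigmeet => x; rewrite -qhom_adj tensA.
exact: le_trans (tens_le (psh_homP phi psi x) (lexx _)) (psh_homP psi chi x).
Qed.

Definition psh X : vcat V :=
  VCat (@psh_hom_refl X) (@psh_hom_trans X).

Lemma psh_precomp_subproof X Y (r : distributor Y X) (phi psi : psh X) :
  vhom phi psi <= vhom (dcomp phi r : psh Y) (dcomp psi r : psh Y).
Proof.
apply: le_bigmeet => y; rewrite -qhom_adj /= tens_bigjoinl.
apply: bigjoin_le => x; rewrite -tensA.
apply: le_trans (le_bigjoin (fun x => r y x ⊗ psi x tt) x).
by apply: tens_ler; apply: psh_homP.
Qed.

Definition psh_precomp X Y (r : distributor Y X) : vfunctor (psh X) (psh Y) :=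
  @VFunctor d V (psh X) (psh Y) (fun phi => dcomp phi r)
    (@psh_precomp_subproof X Y r).

Definition psh_map X Y (f : vfunctor X Y) : vfunctor (psh X) (psh Y) :=
  psh_precomp (upper_star f).

Lemma dcompE X Y Z (s : distributor Y Z) (r : distributor X Y) x z :
  dcomp s r x z = bigjoin (fun y => r x y ⊗ s y z).
Proof. by []. Qed.

Lemma dcompA W X Y Z (t : distributor Y Z) (s : distributor X Y)
    (r : distributor W X) :
  dcomp t (dcomp s r) = dcomp (dcomp t s) r.
Proof.
apply: distributor_ext => w z; apply/le_anti/andP; split.
  apply: bigjoin_le => y /=; rewrite tens_bigjoinl; apply: bigjoin_le => x.
  apply: le_trans (le_bigjoin (fun x => r w x ⊗ dcomp t s x z) x).
  rewrite -tensA; apply: tens_ler.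
  exact: (le_bigjoin (fun y => s x y ⊗ t y z) y).
apply: bigjoin_le => x /=; rewrite tens_bigjoinr; apply: bigjoin_le => y.
apply: le_trans (le_bigjoin (fun y => dcomp s r w y ⊗ t y z) y).
rewrite tensA; apply: tens_le => //.
exact: (le_bigjoin (fun x => r w x ⊗ s x y) x).
Qed.

(* r . f_* is r restricted along f. *)
Lemma dcomp_lower_starE X Y Z (r : distributor Y Z) (f : vfunctor X Y) x z :
  dcomp r (lower_star f) x z = r (f x) z.
Proof.
apply/le_anti/andP; split.
  by apply: bigjoin_le => y; apply: dist_hom_left.
apply: le_trans (le_bigjoin (fun y => vhom (f x) y ⊗ r y z) (f x)).
by rewrite -[X in X <= _]tens1q; apply: tens_le => //; apply: vhom_refl.
Qed.

Lemma dcomp_upper_starE X Y Z (f : vfunctor Z Y) (r : distributor X Y) x z :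
  dcomp (upper_star f) r x z = r x (f z).
Proof.
apply/le_anti/andP; split.
  by apply: bigjoin_le => y; apply: dist_hom_right.
apply: le_trans (le_bigjoin (fun y => r x y ⊗ vhom y (f z)) (f z)).
by rewrite -[X in X <= _]tensq1; apply: tens_ler; apply: vhom_refl.
Qed.

Lemma psh_map_id X : psh_map (vid X) = vid (psh X).
Proof.
by apply: vfunctor_ext => phi; apply: distributor_ext => x [];
  exact: (dcomp_lower_starE phi (vid X)).
Qed.

Lemma upper_star_comp X Y Z (g : vfunctor Y Z) (f : vfunctor X Y) :
  upper_star (vcomp g f) = dcomp (upper_star f) (upper_star g).
Proof.
by apply: distributor_ext => z x; rewrite dcomp_upper_starE.
Qed.

Lemma psh_map_comp X Y Z (g : vfunctor Y Z) (f : vfunctor X Y) :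
  psh_map (vcomp g f) = vcomp (psh_map g) (psh_map f).
Proof.
by apply: vfunctor_ext => phi /=; rewrite upper_star_comp dcompA.
Qed.

Definition psh_endofunctor : endofunctor V :=
  Endofunctor psh_map_id psh_map_comp.

Lemma yoneda_subproof X (x x' : X) :
  vhom x x' <=
  vhom (upper_star (vpoint x) : psh X) (upper_star (vpoint x') : psh X).
Proof. by apply: le_bigmeet => z; rewrite -qhom_adj; apply: vhom_trans. Qed.

Definition yoneda X : vfunctor X (psh X) :=
  @VFunctor d V X (psh X) (fun x => upper_star (vpoint x))
    (@yoneda_subproof X).

Lemma yoneda_natural X Y (f : vfunctor X Y) :
  vcomp (psh_map f) (yoneda X) = vcomp (yoneda Y) f.
Proof.
apply: vfunctor_ext => x; apply: distributor_ext => y e.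
exact: (dcomp_upper_starE (vpoint x) (upper_star f)).
Qed.

Definition psh_unit : nattrans (id_endofunctor V) psh_endofunctor :=
  @NatTrans d V (id_endofunctor V) psh_endofunctor yoneda yoneda_natural.

Definition psh_mul_comp X : vfunctor (psh (psh X)) (psh X) :=
  psh_precomp (lower_star (yoneda X)).

Lemma yoneda_lemma X (x : X) (phi : psh X) : vhom (yoneda X x) phi = phi x tt.
Proof.
apply/le_anti/andP; split.
  apply: le_trans (psh_homP (yoneda X x) phi x).
  by rewrite -[X in X <= _]tens1q; apply: tens_le => //; apply: vhom_refl.
by apply: le_bigmeet => z; rewrite -qhom_adj; apply: dist_hom_left.
Qed.

Lemma psh_mulE X (Gamma : psh (psh X)) x :
  psh_mul_comp X Gamma x tt = bigjoin (fun phi : psh X => phi x tt ⊗ Gamma phi tt).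
Proof.
change (bigjoin (fun phi => vhom (yoneda X x) phi ⊗ Gamma phi tt) =
  bigjoin (fun phi : psh X => phi x tt ⊗ Gamma phi tt)).
by congr bigjoin; apply/funext => phi; rewrite yoneda_lemma.
Qed.

Lemma psh_mulyE X (Gamma : psh (psh X)) x :
  psh_mul_comp X Gamma x tt = Gamma (yoneda X x) tt.
Proof. exact: (dcomp_lower_starE Gamma (yoneda X)). Qed.

Lemma psh_mul_natural X Y (f : vfunctor X Y) :
  vcomp (psh_map f) (psh_mul_comp X) =
  vcomp (psh_mul_comp Y) (psh_map (psh_map f)).
Proof.
apply: vfunctor_ext => Gamma; apply: distributor_ext => y [].
rewrite [RHS]psh_mulyE.
change (bigjoin (fun x => vhom y (f x) ⊗ psh_mul_comp X Gamma x tt) =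
  bigjoin (fun phi => vhom (yoneda Y y) (psh_map f phi) ⊗ Gamma phi tt)).
apply/le_anti/andP; split; apply: bigjoin_le.
  move=> x; rewrite psh_mulyE.
  apply: le_trans (le_bigjoin (fun phi => _) (yoneda X x)).
  rewrite yoneda_lemma; apply: tens_le => //.
  by rewrite [X in _ <= X](dcomp_upper_starE (vpoint x) (upper_star f)).
move=> phi; rewrite yoneda_lemma /= tens_bigjoinl; apply: bigjoin_le => x.
apply: le_trans (le_bigjoin (fun x => _) x).
rewrite -tensA; apply: tens_ler; rewrite [X in _ <= X]psh_mulE.
exact: (le_bigjoin (fun phi : psh X => phi x tt ⊗ Gamma phi tt) phi).
Qed.

Definition psh_mul :
    nattrans (comp_endofunctor psh_endofunctor psh_endofunctor) psh_endofunctor :=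
  @NatTrans d V (comp_endofunctor psh_endofunctor psh_endofunctor)
    psh_endofunctor psh_mul_comp psh_mul_natural.

Lemma psh_mul_unitl X : vcomp (psh_mul X) (psh_unit (psh X)) = vid (psh X).
Proof.
apply: vfunctor_ext => phi; apply: distributor_ext => x [].
by rewrite [LHS]psh_mulyE; apply: yoneda_lemma.
Qed.

Lemma psh_mul_unitr X :
  vcomp (psh_mul X) (psh_map (psh_unit X)) = vid (psh X).
Proof.
apply: vfunctor_ext => phi; apply: distributor_ext => x [].
rewrite [LHS](psh_mulyE (psh_map (yoneda X) phi)).
rewrite -[RHS](dcomp_lower_starE phi (vid X)).
change (bigjoin (fun x' => vhom (yoneda X x) (yoneda X x') ⊗ phi x' tt) =
  bigjoin (fun x' => vhom x x' ⊗ phi x' tt)); congr bigjoin.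
by apply/funext => x'; rewrite (yoneda_lemma x (yoneda X x')).
Qed.

Lemma psh_mul_assoc X :
  vcomp (psh_mul X) (psh_map (psh_mul X)) =
  vcomp (psh_mul X) (psh_mul (psh X)).
Proof.
apply: vfunctor_ext => Xi; apply: distributor_ext => x [].
rewrite [LHS]psh_mulyE [RHS]psh_mulyE [RHS]psh_mulyE.
rewrite -[RHS](dcomp_lower_starE Xi (vid _)).
change (bigjoin (fun Gamma => vhom (yoneda X x) (psh_mul_comp X Gamma)
    ⊗ Xi Gamma tt) =
  bigjoin (fun Gamma => vhom (yoneda (psh X) (yoneda X x)) Gamma
    ⊗ Xi Gamma tt)); congr bigjoin.
by apply/funext => Gamma; rewrite !yoneda_lemma psh_mulyE.
Qed.

Definition presheaf_monad : monad V :=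
  @Monad d V psh_endofunctor psh_mul psh_unit psh_mul_assoc psh_mul_unitl
    psh_mul_unitr.

End PresheafMonad.

(* Main.v *)
Require Import Defs.
From mathcomp Require Import all_boot all_order.
From mathcomp Require boolp.

(* Commutativity gives one half of the BC*-condition; the other half holds as
   soon as every pair (x, z) has a w with Y(f x, h z) <= X(x, g w) and
   k <= Z(l w, z).  For P and m such a w comes from an adjunction:
   - for P, from Pf -| (- . f_* ), with w = psi . l_*, since
     PY(Pf phi, Ph psi) = PX(phi, psi . h^* . f_* ) = PX(phi, Pg (psi . l_* ));
   - for m, from m -| yP, with w = y phi, since
     PY(m Gamma, Pf phi) = PPY(Gamma, y (Pf phi)) = PPY(Gamma, PPf (y phi)).
   For y, both sides are identified by the Yoneda lemma. *)

Set Implicit Arguments.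
Unset Strict Implicit.
Unset Printing Implicit Defensive.

Import Order.TTheory.
Local Open Scope order_scope.

Section BCstar.
Context {d : Order.disp_t} {V : quantaleType d}.
Implicit Types W X Y Z : vcat V.

Lemma BCstar_square_witness W X Y Z (l : vfunctor W Z) (g : vfunctor W X)
    (h : vfunctor Z Y) (f : vfunctor X Y) :
  vcomp h l = vcomp f g ->
  (forall x z, exists2 w,
     vhom (f x) (h z) <= vhom x (g w) & qunit <= vhom (l w) z) ->
  BCstar_square l g h f.
Proof.
move=> comm wit; split=> //; apply: distributor_ext => x z.
rewrite dcomp_upper_starE /=; apply/le_anti/andP; split.
  have [w le_w unit_w] := wit x z.
  apply: le_trans (le_bigjoin (fun w => vhom x (g w) ⊗ vhom (l w) z) w).
  by rewrite -[X in X <= _]tensq1; apply: tens_le.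
apply: bigjoin_le => w; apply: le_trans (vhom_trans _ (f (g w)) _).
apply: tens_le; first exact: vfunP.
(* [f (g w) = h (l w)] by commutativity, so functoriality of [h] bounds the second factor. *)
by have /= <- := congr1 (fun k : vfunctor W Y => k w) comm; apply: vfunP.
Qed.

(** It suffices to evaluate at [f x], because [phi x <= Pf phi (f x)]. *)
Lemma psh_map_adj X Y (f : vfunctor X Y) (phi : psh X) (psi : psh Y) :
  vhom (psh_map f phi) psi <= vhom phi (psh_precomp (lower_star f) psi).
Proof.
apply: le_bigmeet => x; rewrite -qhom_adj /= [X in _ <= X]dcomp_lower_starE.
apply: le_trans (psh_homP (psh_map f phi) psi (f x)).
apply: tens_le => //=.
apply: le_trans (le_bigjoin (fun x' => vhom (f x) (f x') ⊗ phi x' tt) x).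
by rewrite -[X in X <= _]tens1q; apply: tens_le => //; apply: vhom_refl.
Qed.

Lemma psh_map_counit X Y (f : vfunctor X Y) (psi : psh Y) :
  qunit <= vhom (psh_map f (psh_precomp (lower_star f) psi)) psi.
Proof.
apply: le_bigmeet => y; rewrite -qhom_adj tensq1; apply: bigjoin_le => x.
by rewrite [X in _ ⊗ X]dcomp_lower_starE; apply: dist_hom_left.
Qed.

(** [chi x ⊗ Gamma chi] is one term of the join giving [m Gamma] at [x]. *)
Lemma psh_mul_adj X (Gamma : psh (psh X)) (phi : psh X) :
  vhom (psh_mul_comp X Gamma) phi <= vhom Gamma (yoneda (psh X) phi).
Proof.
apply: le_bigmeet => chi; rewrite -qhom_adj; apply: le_bigmeet => x.
rewrite -qhom_adj tensA.
apply: le_trans (psh_homP (psh_mul_comp X Gamma) phi x).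
apply: tens_le => //; rewrite psh_mulE.
exact: (le_bigjoin (fun psi : psh X => psi x tt ⊗ Gamma psi tt) chi).
Qed.

Lemma psh_BCstar : functor_BCstar (psh_endofunctor V).
Proof.
move=> W X Y Z l g h f [comm bc]; apply: BCstar_square_witness.
  by rewrite -!fmap_comp comm.
move=> phi psi; exists (psh_precomp (lower_star l) psi).
  apply: le_trans (psh_map_adj _ _ _) _ => /=.
  (* The BC*-hypothesis gives [psi . h^* . f_* = psi . l_* . g^*], which is [Pg] of the witness. *)
  by rewrite -[X in psh_hom phi X <= _]dcompA bc dcompA.
exact: psh_map_counit.
Qed.

Lemma psh_mul_BCstar : nattrans_BCstar (psh_mul V).
Proof.
move=> X Y f; apply: BCstar_square_witness; first exact: naturality.
move=> Gamma phi; exists (yoneda (psh X) phi).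
  apply: le_trans (psh_mul_adj _ _) _.
  suff <- : psh_map (psh_map f) (yoneda (psh X) phi) =
            yoneda (psh Y) (psh_map f phi) by [].
  exact: (congr1 (fun k : vfunctor _ _ => k phi)
    (yoneda_natural (psh_map f))).
(* The unit law makes [m] send the witness back to [phi]. *)
suff -> : psh_mul V X (yoneda (psh X) phi) = phi by apply: vhom_refl.
exact: (congr1 (fun k : vfunctor _ _ => k phi) (psh_mul_unitl X)).
Qed.

Lemma psh_unit_BCstar : nattrans_BCstar (psh_unit V).
Proof.
move=> X Y f; split; first exact: naturality.
apply: distributor_ext => y phi; rewrite dcomp_upper_starE.
(* The left side is now the join over [x] of [Y(y, f x) ⊗ phi x]. *)
rewrite [LHS](yoneda_lemma y (psh_map f phi)) /= /rcomp; congr bigjoin.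
apply/boolp.funext => x; congr (_ ⊗ _).
exact/esym/(yoneda_lemma x phi).
Qed.

End BCstar.

Theorem theorem3p7 (d : Order.disp_t) (V : quantaleType d) :
  fully_BCstar (presheaf_monad V).
Proof.
split; [exact: psh_BCstar|exact: psh_mul_BCstar|exact: psh_unit_BCstar].
Qed.
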